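(* Let $X$ be a compact metric space with ${\rm dim}(X)=d<\infty$ and $T:X\to X$ an aperiodic local homeomorphism such that $T$ maps zero-dimensional subsets to zero-dimensional subsets. Let $U\subseteq X$ be open. Then for every $k\in\mathbb{N}$ and every open $V\subseteq X$ with $\partial U\subseteq V$, there is an open set $U'$ with \[U\subseteq U'\subseteq U\cup V\quad\text{and}\quad\partial U'\subseteq V\] such that the family $\{T^{-i}(\partial U'): i=0,1,\dots,k-1\}$ is in general position.
   Context: Aperiodic: no $x$ with $T^n(x)=x$ for some $n\ge1$. $T^{-i}(A)$ denotes the preimage of $A$ under $T^i$. ${\rm dim}$ is covering dimension. A family $B$ of subsets of $X$ (with ${\rm dim}(X)=d$) is in general position if for every finite subfamily $S\subseteq B$ with $m$ elements, ${\rm dim}(\bigcap S)\le\max\{-1,d-m\}$ (with ${\rm dim}(\varnothing)=-1$). *)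

(* Defs.v *)
From HB Require Import structures.
From mathcomp Require Import all_boot all_order all_algebra.
From mathcomp Require Import all_classical all_reals topology.
Set Implicit Arguments. Unset Strict Implicit. Unset Printing Implicit Defensive.
Import Order.TTheory GRing.Theory Num.Theory.
Local Open Scope classical_set_scope.
Local Open Scope ring_scope.

Section Defs.
Context {X : topologicalType}.

(* Lebesgue covering dimension of a subspace A of X is <= n (n : nat):
   every finite cover of A by (relatively) open sets has a finite
   (relatively) open refinement covering A of order <= n+1, i.e. no
   point of A lies in n+2 members with distinct indices.
   Relatively open subsets of A are traces A `&` O of open O of X. *)
Definition covdim_le_nat (A : set X) (n : nat) : Prop :=
  forall (m : nat) (U : 'I_m -> set X),
    (forall i, open (U i)) -> A `<=` \bigcup_i U i ->
    exists (m' : nat) (W : 'I_m' -> set X),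
      [/\ (forall j, open (W j)),
          A `<=` \bigcup_j W j,
          (forall j, exists i, A `&` W j `<=` U i) &
          (forall s : 'I_(n.+2) -> 'I_m', injective s ->
             ~ (exists x, A x /\ forall t, W (s t) x))].

(* dim A <= n for n : int, with dim(empty) = -1. *)
Definition covdim_le (A : set X) (n : int) : Prop :=
  match n with
  | Posz k => covdim_le_nat A k
  | Negz 0 => A = set0
  | Negz _ => False
  end.

Definition covdim_eq (A : set X) (n : int) : Prop :=
  covdim_le A n /\ ~ covdim_le A (n - 1).

Definition boundary (A : set X) : set X := closure A `\` interior A.

Definition preimg_iter (T : X -> X) (i : nat) (A : set X) : set X :=
  [set x | A (iter i T x)].

Definition aperiodic (T : X -> X) : Prop :=
  forall (x : X) (n : nat), (0 < n)%N -> iter n T x <> x.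

Definition local_homeomorphism (T : X -> X) : Prop :=
  continuous T /\
  forall x : X, exists W : set X,
    [/\ open W, W x, open (T @` W), {in W &, injective T} &
        (forall O, open O -> open (T @` (O `&` W)))].

Definition general_position (d : int) (k : nat) (B : 'I_k -> set X) : Prop :=
  forall S : {set 'I_k},
    covdim_le [set x | forall i, i \in S -> B i x]
              (Num.max (-1) (d - (#|S|)%:Z)).

End Defs.

(* Main.v *)
Require Import Defs.
From HB Require Import structures.
From mathcomp Require Import all_boot all_order all_algebra.
From mathcomp Require Import all_classical all_reals topology.
Import Order.TTheory GRing.Theory Num.Theory.
Local Open Scope classical_set_scope.
Local Open Scope ring_scope.

(** Call the dimension of a closed set "less than [n]" when its finite open
covers shrink to open covers in which no point lies in more than [n] members.
For a closed [Y] of dimension less than [n + 1], take a fine cover [G 0] of [Y]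
and repeatedly replace it by [G (l + 1)], whose members are unions of members
of a much finer cover of multiplicity at most [n + 1], assigned so that the
closure of [G (l + 1) i] lies in [G l i].  The points lying in more than [n]
closed members then split into finitely many relatively open pieces of small
diameter, and as [l] grows they decrease to a zero-dimensional compact set [E];
a closed subset of [Y] missing [E] is finely covered with multiplicity at most
[n] by some [G l].  Doing this for countably many meshes yields zero-dimensional
compact sets such that every closed subset of [Y] missing all of them has
dimension less than [n].

Since countably many zero-dimensional compact sets can be avoided by the
boundary of a neighbourhood of a closed set, cover the boundary of [U] by
finitely many such neighbourhoods [N j], chosen successively: each lies in an
open set not returning to itself within time [k] (aperiodicity), and its
boundary avoids the images under [T^i] of the zero-dimensional sets attached to
all intersections of preimages of the earlier boundaries.  Then
[U' := U `|` \bigcup_j N j] works, its boundary being contained in the union of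
the boundaries of the [N j]. *)

(** * Covering dimension through shrinkings of finite covers *)

Section CoveringDimension.
Set Implicit Arguments. Unset Strict Implicit. Unset Printing Implicit Defensive.
Context {X : topologicalType}.
Implicit Types (A B C K O : set X) (n : nat).

Definition mult {I : finType} (W : I -> set X) (x : X) : nat :=
  #|[pred i | `[< W i x >]]|.

(* dim A < n; [dimlt A 0] says that A is empty. *)
Definition dimlt A n := forall (I : finType) (U : I -> set X),
  (forall i, open (U i)) -> A `<=` \bigcup_i U i ->
  exists W : I -> set X,
    [/\ (forall i, open (W i)), (forall i, W i `<=` U i),
        A `<=` \bigcup_i W i & forall x, A x -> (mult W x <= n)%N].

Lemma mult_le (I : finType) (W W' : I -> set X) x :
  (forall i, W i x -> W' i x) -> (mult W x <= mult W' x)%N.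
Proof.
move=> WW'; apply: subset_leq_card; apply/fintype.subsetP => i.
by rewrite !inE => /WW'.
Qed.

(** Used whenever members of a refinement are merged along [phi]: the indices in [J] counted at [x]
    map onto a set containing those counted in [I]. *)
Lemma mult_amalgam (I J : finType) (phi : J -> I)
    (W' : I -> set X) (W : J -> set X) x :
  (forall i, W' i x -> exists2 j, phi j = i & W j x) ->
  (mult W' x <= mult W x)%N.
Proof.
move=> h; apply: leq_trans (leq_image_card phi _).
apply: subset_leq_card; apply/fintype.subsetP => i; 
rewrite inE => /h[j <- Wj].
by apply/fintype.imageP; exists j => //; rewrite inE.
Qed.

Lemma mult_gt0 (I : finType) (W : I -> set X) x i : W i x -> (0 < mult W x)%N.
Proof. by move=> Wi; apply/card_gt0P; exists i; rewrite inE. Qed.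

Lemma mult_injP (I : finType) (W : I -> set X) x n :
  (n <= mult W x)%N <->
  exists2 s : 'I_n -> I, injective s & forall t, W (s t) x.
Proof.
split=> [nW|[s sinj sW]].
  exists (fun t => enum_val (widen_ord nW t)).
    by move=> t u /enum_val_inj/(congr1 val) /= /val_inj.
  by move=> t; have := enum_valP (widen_ord nW t); rewrite inE.
rewrite -[n]card_ord -(card_codom sinj); apply: subset_leq_card.
by apply/fintype.subsetP => i /codomP[t ->]; rewrite inE.
Qed.

(** A refinement becomes a shrinking with the same index set once all members assigned to one member
    of the cover are merged. Dimension at most [n] allows [n + 1] members at a point, hence the
    shift. *)
Lemma covdim_le_natP A n : covdim_le_nat A n <-> dimlt A n.+1.
Proof.
split=> [dA I U Uo AU | dA m U Uo AU].
  have [||m [W [Wo AW WU ordW]]] := dA #|I| (fun k => U (enum_val k)).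
  - by move=> i; exact: Uo.
  - by move=> x /AU[i _ Ui]; exists (enum_rank i); rewrite ?enum_rankK.
  have [phi phiU] := choice WU.
  exists (fun i => U i `&` \bigcup_(j in [set j | enum_val (phi j) = i]) W j).
  split=> [i|i x []//|x Ax|x Ax].
  - by apply: openI => //; apply: bigcup_open => j _; exact: Wo.
  - have [j _ Wj] := AW x Ax; exists (enum_val (phi j)) => //.
    by split; [exact: phiU | exists j].
  - apply: leq_trans (_ : mult W x <= _)%N.
      apply: (mult_amalgam (phi := fun j => enum_val (phi j))) => i [_ [j]].
      by exists j.
    rewrite leqNgt; apply/negP => /mult_injP[s sinj sW].
    by apply: (ordW s sinj); exists x.
have [W [Wo WU AW Wn]] := dA _ U Uo AU.
exists m, W; split=> //[j|s sinj [x [Ax sW]]]; first by exists j => x [_ /WU].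
have : (n.+2 <= mult W x)%N by apply/mult_injP; exists s.
by rewrite leqNgt ltnS Wn.
Qed.

Lemma dimlt_set0 n : dimlt set0 n.
Proof. by move=> I U Uo _; exists U; split=> // x. Qed.

Lemma dimlt0 A : dimlt A 0 <-> A = set0.
Proof.
split=> [dA|->]; last exact: dimlt_set0.
have [//||W [_ _ AW Wn]] := dA unit (fun=> setT).
- by move=> _; exact: openT.
- by move=> x _; exists tt.
rewrite -subset0 => x Ax; have [i _ /mult_gt0] := AW _ Ax.
by rewrite ltnNge Wn.
Qed.

(** Adding the complement of [C] to every member turns a cover of [C] into one of [A]; this needs at
    least one member, so an empty index set is treated apart. *)
Lemma dimlt_closed_sub A C n : closed C -> C `<=` A -> dimlt A n -> dimlt C n.
Proof.
move=> Cc CA dA I U Uo CU.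
have [[i0 _]|I0] := pselect (exists i : I, True); last first.
  by exists U; split=> // [i|x /CU[i _ _]] //; case: I0; exists i.
have [||W [Wo WU AW Wn]] := dA I (fun i => U i `|` ~` C).
- by move=> i; apply: openU => //; exact: closed_openC.
- move=> x _; have [/CU[i _ Ui]|nC] := pselect (C x); first by exists i => //; left.
  by exists i0 => //; right.
exists (fun i => W i `&` U i); split=> [i|i x []//|x Cx|x Cx].
- exact: openI.
- by have [i _ Wi] := AW _ (CA _ Cx); exists i => //; split=> //; case: (WU _ _ Wi).
- by apply: leq_trans (Wn _ (CA _ Cx)); apply: mult_le => i [].
Qed.

(** Two successive shrinkings suffice: [step] bounds the multiplicity on one set and leaves the
    cover unchanged off it, and the second shrinking cannot raise the multiplicity on the first
    set. *)
Lemma dimlt_closedU A B n : closed A -> closed B ->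
  dimlt A n -> dimlt B n -> dimlt (A `|` B) n.
Proof.
have step C D (I : finType) (U : I -> set X) : closed C -> dimlt C n ->
    (forall i, open (U i)) -> C `|` D `<=` \bigcup_i U i ->
    exists W : I -> set X, [/\ (forall i, open (W i)), (forall i, W i `<=` U i),
      C `|` D `<=` \bigcup_i W i & forall x, C x -> (mult W x <= n)%N].
  move=> Cc dC Uo CU; have [|W [Wo WU CW Wn]] := dC _ U Uo.
    by move=> x Cx; apply: CU; left.
  exists (fun i => (U i `&` ~` C) `|` W i); split=> [i|i x [[]|/WU]//|x CDx|x Cx].
  - by apply: openU => //; apply: openI => //; exact: closed_openC.
  - have [/CW[i _ Wi]|nCx] := pselect (C x); first by exists i => //; right.
    by have [i _ Ui] := CU _ CDx; exists i => //; left.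
  - by apply: leq_trans (Wn _ Cx); apply: mult_le => i [[]|].
move=> Ac Bc dA dB I U Uo AU.
have [W [Wo WU AW Wn]] := step _ _ _ _ Ac dA Uo AU.
rewrite setUC in AW; have [W' [W'o W'W AW' W'n]] := step _ _ _ _ Bc dB Wo AW.
rewrite setUC in AW'; exists W'; split=> // [i x /W'W/WU//|x [Ax|]]; last exact: W'n.
by apply: leq_trans (Wn _ Ax); apply: mult_le => i; exact: W'W.
Qed.

Lemma dimlt_closed_bigU {J : eqType} (s : seq J) (D : J -> set X) n :
  (forall j, j \in s -> closed (D j) /\ dimlt (D j) n) ->
  closed [set x | exists2 j, j \in s & D j x] /\
  dimlt [set x | exists2 j, j \in s & D j x] n.
Proof.
elim: s => [|j s IHs] Ds.
  have -> : [set x | exists2 j, j \in [::] & D j x] = set0.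
    by rewrite -subset0 => x [].
  by split; [exact: closed0|exact: dimlt_set0].
have [i si|sc sn] := IHs; first by apply: Ds; rewrite inE si orbT.
have [jc jn] := Ds j (mem_head _ _).
have -> : [set x | exists2 i, i \in j :: s & D i x] =
    D j `|` [set x | exists2 i, i \in s & D i x].
  apply/seteqP; split=> x [].
  - by move=> i; rewrite inE => /predU1P[->|si Di]; [left|right; exists i].
  - by exists j => //; exact: mem_head.
  - by case=> i si Di; exists i => //; rewrite inE si orbT.
by split; [exact: closedU|exact: dimlt_closedU].
Qed.

(** Here [d] is one more than the dimension of the space; truncated subtraction takes the place of
    the maximum with -1. *)
Lemma covdim_le_dimlt A (d m : nat) : dimlt A (d - m) ->
  covdim_le A (Num.max (-1) (d%:Z - 1 - m%:Z)).
Proof.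
have [dm|md] := leqP d m.
  have -> : Num.max (-1) (d%:Z - 1 - m%:Z) = -1.
    apply/max_idPl; rewrite addrAC gerDr subr_le0 lez_nat //.
  by rewrite (eqP dm) => /dimlt0.
rewrite -subnSK// => /covdim_le_natP.
have -> : Num.max (-1) (d%:Z - 1 - m%:Z) = Posz (d - m.+1) => //.
rewrite max_r; first by rewrite -subzn// -addrA -opprD -PoszD add1n.
by rewrite addrAC lerBDr addNr subr_ge0 lez_nat ltnW.
Qed.

Lemma mult_closed_usc (I : finType) (Z : I -> set X) n :
  (forall i, closed (Z i)) -> open [set x | (mult Z x <= n)%N].
Proof.
move=> Zc; rewrite openE => x /= Zn.
have : \forall y \near x, forall i, ~ Z i x -> ~ Z i y.
  apply: filter_forall => i; apply: filter_imply => nZ.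
  by apply: open_nbhs_nbhs; split => //; exact: closed_openC.
apply: filterS => y h; apply: leq_trans Zn; apply: mult_le => i Zy.
by apply: contrapT => /h.
Qed.

Lemma compact_nbhs_subcover K (N : X -> set X) : compact K ->
  (forall x, K x -> nbhs x (N x)) ->
  exists s : seq X, (forall x, x \in s -> K x) /\
    forall y, K y -> exists2 x, x \in s & N x y.
Proof.
move=> /compact_near_coveringP Kc Kn.
(* [F] is the filter of growing finite lists: compactness, in its near-covering form, then yields
   one list that serves every point of [K]. *)
pose F : set_system (seq X) := 
  [set P | exists s0 : seq X, forall s : seq X, {subset s0 <= s} -> P s].
have FF : Filter F.
  split; first by exists [::].
  - move=> P Q [s Ps] [t Qt]; exists (s ++ t) => u stu.
    by split; [apply: Ps|apply: Qt] => z zs; apply: stu; rewrite mem_cat zs ?orbT.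
  - by move=> P Q PQ [s Ps]; exists s => t /Ps/PQ.
have [|s0 /(_ s0 (fun x => id)) s0K] := Kc _ F
    (fun s y => exists2 x, x \in s & K x /\ N x y) FF.
  move=> x Kx; exists (N x, [set s | x \in s]) => /=.
    by split; [exact: Kn|exists [:: x] => s; apply; exact: mem_head].
  by move=> [y s] [/= Ny xs]; exists x.
exists [seq x <- s0 | `[< K x >]]; split=> [x|y /s0K[x xs [Kx Nx]]].
  by rewrite mem_filter => /andP[/asboolP].
by exists x => //; rewrite mem_filter xs andbT; apply/asboolP.
Qed.

End CoveringDimension.

(** * Shrinking open covers in a compact Hausdorff space *)

Section CompactShrinking.
Set Implicit Arguments. Unset Strict Implicit. Unset Printing Implicit Defensive.
Context {X : topologicalType} (Xhaus : hausdorff_space X) (Xcpt : compact [set: X]).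
Implicit Types (A B C K O : set X) (n : nat).

Lemma closed_cpt A : closed A -> compact A.
Proof. by move=> Ac; apply: subclosed_compact Xcpt _. Qed.

Lemma closure_finite_bigcup (I : finType) (D : set I) (f : I -> set X) :
  closure (\bigcup_(i in D) f i) `<=` \bigcup_(i in D) closure (f i).
Proof.
have cl : closed (\bigcup_(i in D) closure (f i)).
  by apply: closed_bigcup => [|i _]; [exact: finite_finset|exact: closed_closure].
rewrite [X in _ `<=` X]((closure_id _).1 cl); apply: closureS.
by move=> x [i Di fi]; exists i => //; exact: subset_closure.
Qed.

Lemma closed_open_shrink K O : closed K -> open O -> K `<=` O ->
  exists N, [/\ open N, K `<=` N & closure N `<=` O].
Proof.
move=> Kc Oo KO; have [|B KB BO] := compact_normal Xhaus Xcpt Kc (_ : set_nbhs K O).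
  by move=> x Kx; apply: open_nbhs_nbhs; split=> //; exact: KO.
exists B°; split; first exact: open_interior.
  by move=> x Kx; exact: KB.
by apply: subset_trans BO; apply: closureS; exact: interior_subset.
Qed.

(** Finitely many open sets, each with closure inside some [W j], cover [Y]. Uniting those that fit
    in [W j] works because closure commutes with finite unions. *)
Lemma closure_shrink (J : finType) (Y : set X) (W : J -> set X) : closed Y ->
  (forall j, open (W j)) -> Y `<=` \bigcup_j W j ->
  exists W' : J -> set X, [/\ (forall j, open (W' j)),
    (forall j, closure (W' j) `<=` W j) & Y `<=` \bigcup_j W' j].
Proof.
move=> Yc Wo YW.
have /choice[N Nx] x : exists N, Y x ->
    [/\ open N, N x & exists j, closure N `<=` W j].
  have [Yx|nY] := pselect (Y x); last by exists setT.
  have [j _ Wj] := YW _ Yx.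
  have [||N [No xN NW]] := @closed_open_shrink [set x] (W j) _ (Wo j).
  - by apply: compact_closed => //; exact: compact_set1.
  - by move=> _ ->.
  by exists N => _; split=> //; [exact: xN|exists j].
have [x Yx|s [sY Ys]] := @compact_nbhs_subcover _ Y N (closed_cpt Yc).
  by have [No Nxx _] := Nx x Yx; apply: open_nbhs_nbhs.
pose P j := [set k : 'I_(size s) | closure (N (tnth (in_tuple s) k)) `<=` W j].
exists (fun j => \bigcup_(k in P j) N (tnth (in_tuple s) k)); split=> [j|j|y Yy].
- apply: bigcup_open => k _; have [] // := Nx (tnth (in_tuple s) k).
  by apply: sY; exact: mem_tnth.
- by move=> x /closure_finite_bigcup[k]; exact.
- have [x xs Nxy] := Ys _ Yy; have [_ _ [j Nj]] := Nx x (sY _ xs).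
  have [k xk] : exists k, x = tnth (in_tuple s) k by apply/tnthP.
  by exists j => //; exists k; rewrite /P/= -xk.
Qed.

End CompactShrinking.

(** * Covers by sets of small diameter *)

Section FineCovers.
Set Implicit Arguments. Unset Strict Implicit. Unset Printing Implicit Defensive.
Context {R : realType} {X : pseudoMetricType R}.
Context (Xhaus : hausdorff_space X) (Xcpt : compact [set: X]).
Implicit Types (A B C K O : set X) (n : nat) (e : R).

Definition diam_le {I : Type} (Z : I -> set X) e :=
  forall i x y, Z i x -> Z i y -> ball x e y.

Definition fine_cover A n e := exists (I : finType) (Z : I -> set X),
  [/\ (forall i, open (Z i)), diam_le Z e, A `<=` \bigcup_i Z i &
      forall x, A x -> (mult Z x <= n)%N].

Lemma fine_coverS A B n e e' : B `<=` A -> e <= e' ->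
  fine_cover A n e -> fine_cover B n e'.
Proof.
move=> BA ee' [I [Z [Zo Ze AZ Zn]]]; exists I, Z; split=> //.
- by move=> i x y Zx Zy; apply: le_ball ee' _ _; exact: Ze Zx Zy.
- exact: subset_trans AZ.
- by move=> x /BA; exact: Zn.
Qed.

Lemma lebesgue_number (I : Type) A (U : I -> set X) : compact A ->
  (forall i, open (U i)) -> A `<=` \bigcup_i U i ->
  exists2 e, 0 < e & forall x, A x -> exists i, ball x e `<=` U i.
Proof.
move=> /compact_near_coveringP Ac Uo AU.
suff H : \forall e \near 0^'+, A `<=` [set x | exists i, ball x e `<=` U i].
  have [e [e0 eU]] := filter_ex (filterI (nbhs_right_gt (0 : R)) H).
  by exists e.
apply: Ac => x Ax.
have [i _ Ui] := AU _ Ax.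
have /nbhs_ballP[e /= e0 eU] : nbhs x (U i) by apply: open_nbhs_nbhs.
have e20 : 0 < e / 2 by rewrite divr_gt0.
exists (ball x (e / 2), [set d | d < e / 2]) => /=.
  by split; [exact: nbhsx_ballx|exact: nbhs_right_lt].
move=> [y d] /= [xy de]; exists i => z yz; apply: eU.
by apply: ball_split xy _; apply: le_ball yz; exact: ltW.
Qed.

(** When [e] is a Lebesgue number of the cover, each fine member has its trace on [A] inside one
    [U i]; merging along this assignment keeps the multiplicity. *)
Lemma fine_cover_dimlt A n : compact A ->
  (forall e, 0 < e -> fine_cover A n e) -> dimlt A n.
Proof.
move=> Ac fA I U Uo AU; have [e e0 eU] := lebesgue_number Ac Uo AU.
have [[i0 _]|I0] := pselect (exists i : I, True); last first.
  by exists U; split=> // [i|x /AU[i _ _]] //; case: I0; exists i.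
have [J [Z [Zo Ze AZ Zn]]] := fA e e0.
have /choice[phi phiU] j : exists i, A `&` Z j `<=` U i.
  have [[x [Ax Zx]]|A0] := pselect (A `&` Z j !=set0).
    by have [i xU] := eU _ Ax; exists i => y [Ay Zy]; apply: xU; exact: Ze Zx Zy.
  by exists i0 => x AZx; case: A0; exists x.
exists (fun i => U i `&` \bigcup_(j in [set j | phi j = i]) Z j).
split=> [i|i x []//|x Ax|x Ax].
- by apply: openI => //; apply: bigcup_open => j _; exact: Zo.
- have [j _ Zj] := AZ x Ax; exists (phi j) => //.
  by split; [exact: phiU | exists j].
- apply: leq_trans (Zn _ Ax).
  by apply: (mult_amalgam (phi := phi)) => i [_ [j]]; exists j.
Qed.

(** The cover to shrink consists of the sets small ball meet [G i], indexed by pairs, so that the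
    second component gives [phi]. *)
Lemma dimlt_fine_refinement (I : finType) Y n (G : I -> set X) e : closed Y ->
  0 < e -> dimlt Y n -> (forall i, open (G i)) -> Y `<=` \bigcup_i G i ->
  exists (J : finType) (phi : J -> I) (W : J -> set X),
    [/\ (forall j, open (W j)) /\ (forall j, W j `<=` G (phi j)), diam_le W e,
        Y `<=` \bigcup_j W j & forall x, Y x -> (mult W x <= n)%N].
Proof.
move=> Yc e0 dY Go YG; have e20 : 0 < e / 2 by rewrite divr_gt0.
have [x _|s [_ Ys]] := @compact_nbhs_subcover _ Y (fun x => (ball x (e / 2))°)
    (closed_cpt Xcpt Yc).
  by apply: nbhs_interior; exact: nbhsx_ballx.
pose B (p : 'I_(size s) * I) := (ball (tnth (in_tuple s) p.1) (e / 2))° `&` G p.2.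
have [p|x Yx|W [Wo WB YW Wn]] := dY _ B.
- by apply: openI => //; exact: open_interior.
- have [y ys xy] := Ys _ Yx; have [i _ Gi] := YG _ Yx.
  have [k yk] : exists k, y = tnth (in_tuple s) k by apply/tnthP.
  by exists (k, i) => //; split=> //=; rewrite -yk.
exists _, snd, W; split=> //; first by split=> // p x /WB[].
move=> p x y /WB[/interior_subset xp _] /WB[/interior_subset yp _].
exact: ball_splitr xp yp.
Qed.

(** [G'] groups along [phi] a shrinking [W'] of a fine cover [W]. As the closure of [W' j] lies in
    [W j], a point in more than [n] closed members of [G'] lies in exactly [n + 1] of the sets
    [W j]. *)
Lemma refine_step (I : finType) Y n (G : I -> set X) e : closed Y ->
  0 < e -> dimlt Y n.+1 -> (forall i, open (G i)) -> Y `<=` \bigcup_i G i ->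
  exists G' : I -> set X,
    [/\ forall i, open (G' i), forall i, closure (G' i) `<=` G i,
        Y `<=` \bigcup_i G' i &
        fine_cover
          (Y `&` [set x | (n < mult (fun i => closure (G' i)) x)%N]) 1 e].
Proof.
move=> Yc e0 dY Go YG.
have [J [phi [W [[Wo WG] We YW Wn]]]] := dimlt_fine_refinement Yc e0 dY Go YG.
have [W' [W'o W'W YW']] := closure_shrink Xhaus Xcpt Yc Wo YW.
pose G' i := \bigcup_(j in [set j | phi j = i]) W' j.
have clG' i x : closure (G' i) x -> exists2 j, phi j = i & W j x.
  by move=> /closure_finite_bigcup[j /= ji /W'W]; exists j.
exists G'; split.
- by move=> i; apply: bigcup_open => j _; exact: W'o.
- by move=> i x /clG'[j <- /WG].
- by move=> x /YW'[j _ W'j]; exists (phi j) => //; exists j.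
(* Where the multiplicity is exactly n.+1, the members containing the point are
   determined by any n.+1 of them, so the sets [Z S] are disjoint there. *)
pose Z (S : {set J}) := [set x | #|S| = n.+1 /\ forall j, j \in S -> W j x].
have WZ x S : Y x -> Z S x -> S = finset (fun j => `[< W j x >]).
  move=> Yx [Sn SW]; apply/eqP; rewrite eqEcard Sn; apply/andP; split.
    by apply/fintype.subsetP => j /SW Wj; rewrite finset.in_set; apply/asboolP.
  by apply: leq_trans (Wn x Yx); rewrite cardsE.
exists {set J}, Z; split.
- move=> S; rewrite openE => x [Sn SW].
  have : \forall y \near x, forall j, j \in S -> W j y.
    apply: filter_forall => j; apply: filter_imply => jS.
    by apply: open_nbhs_nbhs; split=> //; exact: SW.
  by apply: filterS => y SWy; split.
- move=> S x y [Sn SWx] [_ SWy]; have [j jS] : exists j, j \in S.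
    by apply/card_gt0P; rewrite Sn.
  by apply: (We j); [exact: SWx|exact: SWy].
- move=> x [Yx nx]; exists (finset (fun j => `[< W j x >])) => //; split.
    apply/eqP; rewrite cardsE eqn_leq Wn//=; apply: leq_trans nx _.
    by apply: (mult_amalgam (phi := phi)) => i /clG'.
  by move=> j; rewrite finset.in_set => /asboolP.
- move=> x [Yx _]; apply/card_le1P => S; rewrite inE => ZS S'; rewrite !inE.
  apply/idP/eqP => [/asboolP ZS'|->]; last exact/asboolP.
  by rewrite (WZ x S) // (WZ x S').
Qed.

End FineCovers.

(** * Zero-dimensional sets that control dimension, and boundaries avoiding them *)

Section ZeroDimensional.
Set Implicit Arguments. Unset Strict Implicit. Unset Printing Implicit Defensive.
Context {R : realType} {X : pseudoMetricType R}.
Context (Xhaus : hausdorff_space X) (Xcpt : compact [set: X]).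
Implicit Types (A B C K O : set X) (n : nat) (e : R).

Lemma exists_invS_le e : 0 < e -> exists k, (k.+1%:R^-1 : R) <= e.
Proof.
move=> e0; exists (Num.truncn e^-1).
by rewrite -[leRHS]invrK lef_pV2 ?posrE ?invr_gt0// ltW// truncnS_gt.
Qed.

(** Two scales are at work: all members of [G l] stay inside those of [G0], hence of diameter at
    most [e], while the mesh tending to 0 concerns only the points of multiplicity above [n]. *)
Lemma zero_dim_core Y n e : closed Y -> 0 < e -> dimlt Y n.+1 ->
  exists E, [/\ closed E, dimlt E 1 & forall C, closed C -> C `<=` Y ->
    C `&` E = set0 -> fine_cover C n e].
Proof.
move=> Yc e0 dY.
have [||I [_ [G0 [[G0o _] G0e YG0 _]]]] :=
    dimlt_fine_refinement Xcpt (G := fun _ : unit => setT) Yc e0 dY.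
- by move=> _; exact: openT.
- by move=> x _; exists tt.
pose ok (G : I -> set X) := (forall i, open (G i)) /\ Y `<=` \bigcup_i G i.
pose clm (G : I -> set X) := mult (fun i => closure (G i)).
(* Guarding the conclusion by [ok] makes [f] total, so that it can be iterated on bare families;
   [okG] recovers the guard by induction. *)
have /choice[f fP] (p : nat * (I -> set X)) : exists G', ok p.2 ->
    [/\ ok G', forall i, closure (G' i) `<=` p.2 i &
        fine_cover (Y `&` [set x | (n < clm G' x)%N]) 1 (p.1.+1%:R^-1)].
  have [[Go YG]|nok] := pselect (ok p.2); last by exists p.2.
  have k0 : 0 < (p.1.+1%:R^-1 : R) by rewrite invr_gt0.
  by have [G' [? ? ? ?]] := refine_step Xhaus Xcpt Yc k0 dY Go YG; exists G'.
pose G := fix G l := if l is l'.+1 then f (l', G l') else G0.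
have okG l : ok (G l).
  by elim: l => [|l IHl]; [exact: conj G0o YG0|have [+ _ _] := fP (l, G l) IHl].
have clG l i : closure (G l.+1 i) `<=` G l i.
  by have [_ + _] := fP (l, G l) (okG l); exact.
have fineG l : fine_cover (Y `&` [set x | (n < clm (G l.+1) x)%N]) 1 l.+1%:R^-1.
  by case: (fP (l, G l) (okG l)).
have GG0 l i : G l i `<=` G0 i.
  by elim: l => [//|l IHl] x Gx; apply: IHl; apply: clG; exact: subset_closure.
have clm_anti l m x : (l <= m)%N -> (clm (G m) x <= clm (G l) x)%N.
  elim: m => [|m IHm]; first by rewrite leqn0 => /eqP->.
  rewrite leq_eqVlt => /predU1P[->//|/IHm]; apply: leq_trans.
  by apply: mult_le => i /clG; exact: subset_closure.
pose E := Y `&` [set x | forall l, (n < clm (G l.+1) x)%N].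
have Ec : closed E.
  apply: closedI => //.
  have -> : [set x | forall l, (n < clm (G l.+1) x)%N] =
      \bigcap_l ~` [set x | (clm (G l.+1) x <= n)%N].
    apply/seteqP; split=> x /= h l; first by move=> _ /=; rewrite leqNgt h.
    by rewrite ltnNge; apply/negP; exact: h.
  apply: closed_bigI => l _; apply: open_closedC.
  by apply: mult_closed_usc => i; exact: closed_closure.
exists E; split=> //.
  apply: fine_cover_dimlt; first exact: closed_cpt.
  move=> d /exists_invS_le[l ld]; apply: fine_coverS ld (fineG l).
  by move=> x [Yx Ex]; split => //; exact: Ex.
move=> C Cc CY CE.
have /compact_near_coveringP Ccov := closed_cpt Xcpt Cc.
(* The sets where the multiplicity is at most [n] are open and increase with [l], so compactness of
   [C] gives a single stage. *)
suff : \forall l \near \oo, C `<=` [set x | (clm (G l.+1) x <= n)%N].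
  case=> l _ /(_ l (leqnn l)) Cl; exists I, (G l.+1).
  have [Go YG] := okG l.+1; split=> //.
  - by move=> i x y /GG0 Gx /GG0 Gy; exact: G0e Gx Gy.
  - by move=> x /CY/YG.
  - move=> x /Cl; apply: leq_trans.
    by apply: mult_le => i; exact: subset_closure.
apply: Ccov => x Cx.
have [l xl] : exists l, (clm (G l.+1) x <= n)%N.
  apply: contrapT => nl; suff: (set0 : set X) x by []; rewrite -CE; split=> //.
  split; first exact: CY.
  by move=> l; rewrite ltnNge; apply/negP => xl; apply: nl; exists l.
exists ([set x | (clm (G l.+1) x <= n)%N], [set m | (l <= m)%N]) => /=.
  split; last exact: nbhs_infty_ge.
  apply: open_nbhs_nbhs; split=> //.
  by apply: mult_closed_usc => i; exact: closed_closure.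
by move=> [y m] /= [yl lm]; apply: leq_trans (clm_anti l.+1 m.+1 y lm) yl.
Qed.

Lemma zero_dim_sets_lowering_dim Y n : closed Y -> dimlt Y n ->
  exists F : nat -> set X, [/\ forall k, closed (F k), forall k, dimlt (F k) 1 &
    forall C, closed C -> C `<=` Y -> (forall k, C `&` F k = set0) -> dimlt C n.-1].
Proof.
move=> Yc; case: n => [/dimlt0->|n dY].
  exists (fun=> set0); split=> [k|k|C _]; [exact: closed0|exact: dimlt_set0|].
  by rewrite subset0 => -> _; exact: dimlt_set0.
have /choice[F FP] (k : nat) : exists E, [/\ closed E, dimlt E 1 &
    forall C, closed C -> C `<=` Y -> C `&` E = set0 -> fine_cover C n k.+1%:R^-1].
  by apply: zero_dim_core => //; rewrite invr_gt0.
exists F; split=> [k|k|C Cc CY CF]; [by case: (FP k)|by case: (FP k)|].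
apply: fine_cover_dimlt; first exact: closed_cpt.
move=> e /exists_invS_le[k ke]; have [_ _ FC] := FP k.
exact: fine_coverS ke (FC _ Cc CY (CF k)).
Qed.

(** A shrinking of the cover by [A] and [B] with multiplicity at most 1 partitions [F]; each piece
    is closed, being the complement in [F] of the other. *)
Lemma zero_dim_split F A B : dimlt F 1 -> closed F -> F `<=` A `|` B ->
  open A -> open B -> exists F1 F2,
  [/\ closed F1, closed F2, F = F1 `|` F2, F1 `<=` A & F2 `<=` B] /\
  F1 `&` F2 = set0.
Proof.
move=> dF Fc FAB Ao Bo.
have [||W [Wo WU FW Wn]] := dF bool (fun b => if b then A else B).
- by case.
- by move=> x /FAB[Ax|Bx]; [exists true|exists false].
have Wd b x : F x -> W b x -> W (~~ b) x -> False.
  move=> Fx Wb Wnb; have /card_le1_eqP/(_ b (~~ b)) := Wn x Fx.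
  by rewrite !inE => /(_ Wb Wnb); case: (b).
have FWC b : F `&` W b = F `&` ~` W (~~ b).
  apply/seteqP; split=> x [Fx Wx]; split=> //; first exact: Wd Wx.
  by have [c _] := FW x Fx; move: Wx; case: b; case: c.
have Fcb b : closed (F `&` W b).
  by rewrite FWC; apply: closedI => //; exact: open_closedC.
exists (F `&` W true), (F `&` W false); split; first split=> //.
- apply/seteqP; split=> x; last by case=> -[].
  by move=> Fx; have [[] _ Wx] := FW x Fx; [left|right].
- by move=> x [_ /WU].
- by move=> x [_ /WU].
- by rewrite -subset0 => x [[Fx Wt] [_ Wf]]; exact: (Wd true x).
Qed.

(** [F] splits into [F1] inside [O] and [F2] off [K]. Both new sets absorb [F1], and the closure of
    the larger avoids [F2], so the shell between them misses [F]. *)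
Lemma shell_step K O F : closed K -> open O -> K `<=` O -> closed F -> dimlt F 1 ->
  exists N M : set X, [/\ open N, open M, K `<=` N, closure N `<=` M &
    closure M `<=` O /\ closure M `&` F `<=` N].
Proof.
move=> Kc Oo KO Fc dF.
have [|//||F1 [F2 [[F1c F2c FE F1O F2K] F12]]] := @zero_dim_split F O (~` K) dF Fc.
- by move=> x _; have [/KO|] := pselect (K x); [left|right].
- exact: closed_openC.
have [|||M [Mo KM MO]] := @closed_open_shrink X Xhaus Xcpt (K `|` F1) (O `&` ~` F2).
- exact: closedU.
- by apply: openI => //; exact: closed_openC.
- move=> x [Kx|F1x]; split; [exact: KO|by move=> /F2K|exact: F1O|].
  by move=> F2x; suff: (set0 : set X) x by []; rewrite -F12.
have [||N [No KN NM]] := @closed_open_shrink X Xhaus Xcpt (K `|` F1) M _ Mo.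
- exact: closedU.
- exact: KM.
exists N, M; split=> //; first by move=> x Kx; apply: KN; left.
split=> [x /MO[]//|x [/MO[_ nF2]]]; rewrite FE => -[F1x|//].
by apply: KN; right.
Qed.

(** Inner sets increase and outer sets decrease, the shell of step [l] missing [F l]; the boundary
    of the union of the inner sets lies in every shell. *)
Lemma boundary_avoiding_nbhd K O (F : nat -> set X) : closed K -> open O ->
  K `<=` O -> (forall k, closed (F k)) -> (forall k, dimlt (F k) 1) ->
  exists N, [/\ open N, K `<=` N, closure N `<=` O &
                forall k, boundary N `&` F k = set0].
Proof.
move=> Kc Oo KO Fc dF.
(* The inner set need not be open here, since the recursion starts at the closed set [K]; for this
   reason [N] below begins with stage 1. *)
pose ok (p : set X * set X) := open p.2 /\ closure p.1 `<=` p.2.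
have /choice[f fP] (q : nat * (set X * set X)) : exists p, ok q.2 ->
    [/\ open p.1, ok p, closure q.2.1 `<=` p.1, closure p.2 `<=` q.2.2 &
        closure p.2 `&` F q.1 `<=` p.1].
  have [[Mo NM]|nok] := pselect (ok q.2); last by exists q.2.
  have [N [M [No Mo' KN NM' [MO' MF]]]] :=
    shell_step (@closed_closure _ _) Mo NM (Fc q.1) (dF q.1).
  by exists (N, M).
pose S := fix S l := if l is l'.+1 then f (l', S l') else (K, O).
have okS l : ok (S l).
  elim: l => [|l IHl]; last by case: (fP (l, S l) IHl).
  by split=> //=; rewrite -((closure_id _).1 Kc).
have SP l : [/\ open (S l.+1).1, closure (S l).1 `<=` (S l.+1).1,
    closure (S l.+1).2 `<=` (S l).2 & closure (S l.+1).2 `&` F l `<=` (S l.+1).1].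
  by case: (fP (l, S l) (okS l)).
have Sup l m : (l <= m)%N -> (S l).1 `<=` (S m).1.
  elim: m => [|m IHm]; first by rewrite leqn0 => /eqP->.
  rewrite leq_eqVlt => /predU1P[->//|/IHm] lm x /lm xm.
  by have [_ + _ _] := SP m; apply; exact: subset_closure.
have Sdown l m : (l <= m)%N -> (S m).2 `<=` (S l).2.
  elim: m => [|m IHm]; first by rewrite leqn0 => /eqP->.
  rewrite leq_eqVlt => /predU1P[->//|/IHm] lm x xm; apply: lm.
  by have [_ _ + _] := SP m; apply; exact: subset_closure.
have S12 l m : (S l).1 `<=` (S m).2.
  move=> x xl; apply: (Sdown _ _ (leq_maxr l m)); have [_] := okS (maxn l m).
  by apply; apply: subset_closure; apply: Sup xl; exact: leq_maxl.
pose N := \bigcup_l (S l.+1).1.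
have No : open N by apply: bigcup_open => l _; case: (SP l).
have clN l : closure N `<=` closure (S l).2.
  by apply: closureS => x [m _]; exact: S12.
exists N; split=> //.
- move=> x Kx; exists 0%N => //.
  by have [_ + _ _] := SP 0%N; apply; exact: subset_closure.
- by move=> x /(clN 1%N); have [_ _ + _] := SP 0%N; apply.
- move=> k; rewrite -subset0 => x [[/(clN k.+1) xM +] Fx].
  rewrite ((interior_id _).1 No); apply; exists k => //.
  by have [_ _ _] := SP k; apply.
Qed.

End ZeroDimensional.

(** * Iterates of the map and boundaries in general position *)

Section GeneralPosition.
Set Implicit Arguments. Unset Strict Implicit. Unset Printing Implicit Defensive.
Context {R : realType} {X : pseudoMetricType R}.
Context (Xhaus : hausdorff_space X) (Xcpt : compact [set: X]).
Context (T : X -> X) (Tcont : continuous T).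
Implicit Types (A B C K O : set X).

Lemma closed_boundary A : closed (boundary A).
Proof.
apply: closedI; first exact: closed_closure.
exact/open_closedC/open_interior.
Qed.

Lemma iter_continuous i : continuous (iter i T).
Proof.
elim: i => [|i IHi] x; first exact: cvg_id.
by apply: (@continuous_comp _ _ _ (iter i T) T x); [exact: IHi|exact: Tcont].
Qed.

Lemma zero_dim_iter_image (Tzero : forall A, covdim_eq A 0 -> covdim_eq (T @` A) 0)
    i A : closed A -> dimlt A 1 ->
  closed (iter i T @` A) /\ dimlt (iter i T @` A) 1.
Proof.
move=> Ac dA; elim: i => [|i [Bc dB]]; first by rewrite image_id.
have -> : iter i.+1 T @` A = T @` (iter i T @` A) by rewrite -image_comp.
set B := _ @` A in Bc dB *; split.
  apply: compact_closed => //; apply: continuous_compact; last exact: closed_cpt.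
  exact: continuous_subspaceT.
(* [Tzero] concerns dimension exactly 0, which excludes the empty set. *)
have [->|B0] := eqVneq B set0; first by rewrite image_set0; exact: dimlt_set0.
have [|/covdim_le_natP//] := Tzero B.
by split; [exact/covdim_le_natP|exact/eqP].
Qed.

(* A pair (i, j) of [s] stands for the preimage under T^i of the boundary of [N j]. *)
Definition iter_meet (N : nat -> set X) (s : seq (nat * nat)) : set X :=
  [set x | forall p, p \in s -> boundary (N p.2) (iter p.1 T x)].

Lemma closed_iter_meet N s : closed (iter_meet N s).
Proof.
have -> : iter_meet N s =
    \bigcap_(p in [set` s]) (iter p.1 T @^-1` boundary (N p.2)) by [].
apply: closed_bigI => p _; apply: preimage_closed; last exact: closed_boundary.
by move=> x _; exact: iter_continuous.
Qed.

(** By induction on [r]. In a nonempty meet at most one pair involves the newest boundary, by the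
    no-return hypothesis, and that pair lowers the dimension bound by one because the boundary
    misses the images of the controlling sets. *)
Lemma generic_nbhds (Tzero : forall A, covdim_eq A 0 -> covdim_eq (T @` A) 0)
    (d k : nat) (K O : nat -> set X) : dimlt [set: X] d ->
  (forall j, [/\ closed (K j), open (O j) & K j `<=` O j]) ->
  (forall j x i i', (i < i' < k)%N -> O j (iter i T x) -> ~ O j (iter i' T x)) ->
  forall r, exists N : nat -> set X,
    (forall j, (j < r)%N -> [/\ open (N j), K j `<=` N j & closure (N j) `<=` O j]) /\
    (forall s, uniq (unzip1 s) -> all (fun p => (p.1 < k) && (p.2 < r))%N s ->
       dimlt (iter_meet N s) (d - size s)).
Proof.
move=> dX KO noret; elim=> [|r [N [NP Ndim]]].
  exists (fun=> set0); split=> // -[|p s] _ /=; last by rewrite andbF.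
  rewrite subn0 => _; apply: dimlt_closed_sub dX => //; exact: closed_iter_meet.
pose good s := uniq (unzip1 s) /\ all (fun p => (p.1 < k) && (p.2 < r))%N s.
have /choice[F FP] s : exists F : nat -> set X,
    [/\ forall l, closed (F l), forall l, dimlt (F l) 1 & good s ->
    forall C, closed C -> C `<=` iter_meet N s -> (forall l, C `&` F l = set0) ->
      dimlt C (d - size s).-1].
  have [[su sk]|ns] := pselect (good s); last first.
    by exists (fun=> set0); split=> // _; [exact: closed0|exact: dimlt_set0].
  have [F [Fc Fd FC]] := zero_dim_sets_lowering_dim Xhaus Xcpt
    (@closed_iter_meet N s) (Ndim s su sk).
  by exists F; split.
(* The images under all iterates of all controlling sets, over all lists [s], are put into one
   sequence by pickling. *)
pose H (m : nat) : set X :=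
  if unpickle m is Some (s, i, l) then iter i T @` F s l else set0.
have HP m : closed (H m) /\ dimlt (H m) 1.
  rewrite /H; case: unpickle => [[[s i] l]|].
    by have [Fc Fd _] := FP s; exact: zero_dim_iter_image.
  by split; [exact: closed0|exact: dimlt_set0].
have [Kc Oo KOr] := KO r.
have [M [Mo KM MO MH]] := boundary_avoiding_nbhd Xhaus Xcpt Kc Oo KOr
  (fun m => (HP m).1) (fun m => (HP m).2).
pose N' j := if j == r then M else N j.
have N'r : N' r = M by rewrite /N' eqxx.
have N'P j : (j < r.+1)%N ->
    [/\ open (N' j), K j `<=` N' j & closure (N' j) `<=` O j].
  rewrite ltnS leq_eqVlt /N'; have [->|jr] //= := eqVneq j r; exact: NP.
exists N'; split=> // s su sk.
have N'N t : all (fun p => (p.1 < k) && (p.2 < r))%N t ->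
    iter_meet N' t `<=` iter_meet N t.
  move=> /allP tk x xt p pt; have /andP[_ pr] := tk p pt; have := xt p pt.
  by rewrite /N' ltn_eqF.
have [|/allPn[p ps]] := boolP (all (fun p => (p.1 < k) && (p.2 < r))%N s).
  move=> sr; apply: dimlt_closed_sub (Ndim s su sr); last exact: N'N.
  exact: closed_iter_meet.
have /andP[pk pr1] := allP sk p ps; rewrite pk /= => pr.
have {pr1} {}pr : p.2 = r by apply/eqP; rewrite eqn_leq -ltnS pr1 leqNgt.
have sE := perm_to_rem ps; set t := rem p s in sE.
have /andP[pt tu] : (p.1 \notin unzip1 t) && uniq (unzip1 t).
  by rewrite -[_ && _]/(uniq (unzip1 (p :: t))) -(perm_uniq (perm_map _ sE)).
have tk : all (fun p => (p.1 < k) && (p.2 < r.+1))%N t.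
  by apply/allP => q qt; apply: (allP sk); exact: mem_rem qt.
have dE : (d - size s)%N = (d - size t).-1 by rewrite (perm_size sE) subnS.
have [tr|/allPn[q qt]] := boolP (all (fun p => (p.1 < k) && (p.2 < r))%N t).
  have [_ _ FC] := FP t; rewrite dE; apply: FC; first by split.
  - exact: closed_iter_meet.
  - by apply: subset_trans (N'N t tr) => x xs q qt; apply: xs; exact: mem_rem qt.
  (* Otherwise the image of [x] under the iterate [p.1] would lie both in the boundary of [M] and in
     a set [H m]. *)
  - move=> l; rewrite -subset0 => x [xs xF].
    suff : (set0 : set X) (iter p.1 T x) by [].
    rewrite -(MH (pickle (t, p.1, l))); split; last by rewrite /H pickleK; exists x.
    by rewrite -N'r -pr; exact: xs.
have /andP[qk qr1] := allP tk q qt; rewrite qk /= => qr.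
have {qr1} {}qr : q.2 = r by apply/eqP; rewrite eqn_leq -ltnS qr1 leqNgt.
(* Two pairs now involve [r], at distinct times below [k]: a point of the meet would return to
   [O r]. *)
suff -> : iter_meet N' s = set0 by exact: dimlt_set0.
rewrite -subset0 => x xs; have inO i : i \in s -> i.2 = r -> O r (iter i.1 T x).
  by move=> /xs[+ _] ir; rewrite ir N'r; exact: MO.
have xp := inO _ ps pr; have xq := inO _ (mem_rem qt) qr.
have [pq|qp|pq] := ltngtP p.1 q.1.
- by apply: noret xp xq; rewrite pq.
- by apply: noret xq xp; rewrite qp.
- by move: pt; rewrite pq => /negP; apply; apply/mapP; exists q.
Qed.

(** For each positive [n < k], the point [x] and its distinct [n]-th iterate have disjoint
    neighbourhoods; continuity gives [Q n], and finitely many such sets are intersected. *)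
Lemma nonreturning_nbhd (Taper : aperiodic T) (k : nat) V x : open V -> V x ->
  exists O, [/\ open O, O x, O `<=` V & forall y i i', (i < i' < k)%N ->
    O (iter i T y) -> ~ O (iter i' T y)].
Proof.
move=> Vo Vx.
have /choice[Q QP] (n : nat) : exists Q, nbhs x Q /\
    ((0 < n)%N -> forall y, Q y -> ~ Q (iter n T y)).
  have [->|n0] := posnP n; first by exists setT; split=> //; exact: filterT.
  have [[A B] /= [xA xB] [Ao Bo AB]] :
      exists2 AB : set X * set X, x \in AB.1 /\ iter n T x \in AB.2 &
        [/\ open AB.1, open AB.2 & AB.1 `&` AB.2 == set0].
    move: Xhaus; rewrite open_hausdorff => /(_ x (iter n T x)) [].
      by apply/eqP => /esym; exact: Taper.
    by move=> AB [? ?] [? ? ?]; exists AB.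
  rewrite !inE in xA xB.
  exists (A `&` iter n T @^-1` B); split.
    apply: filterI; first exact: open_nbhs_nbhs.
    by apply: iter_continuous; exact: open_nbhs_nbhs.
  move=> _ y [_ yB] [yA _]; suff : (set0 : set X) (iter n T y) by [].
  by rewrite -(eqP AB).
exists ((V `&` [set y | forall n : 'I_k, Q n y])°); split.
- exact: open_interior.
- apply: filterI; first exact: open_nbhs_nbhs.
  by apply: filter_forall => n; case: (QP n).
- by move=> y /interior_subset[].
move=> y i i' /andP[ii' i'k] /interior_subset[_ yi] /interior_subset[_ yi'].
have nk : (i' - i < k)%N by apply: leq_ltn_trans i'k; exact: leq_subr.
have [_ /(_ _ (iter i T y))] := QP (i' - i)%N.
rewrite subn_gt0 => /(_ ii' (yi (Ordinal nk))); rewrite -iterD subnK ?(ltnW ii')//.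
by apply; exact: (yi' (Ordinal nk)).
Qed.

Lemma generic_enlargement (Taper : aperiodic T)
    (Tzero : forall A, covdim_eq A 0 -> covdim_eq (T @` A) 0)
    (d k : nat) U V : dimlt [set: X] d -> open U -> open V -> boundary U `<=` V ->
  exists U', [/\ open U', U `<=` U', U' `<=` U `|` V, boundary U' `<=` V &
    forall S : {set 'I_k},
      dimlt [set x | forall i, i \in S -> preimg_iter T i (boundary U') x]
            (d - #|S|)].
Proof.
move=> dX Uo Vo UV.
have /choice[ON ONP] x : exists ON : set X * set X, boundary U x ->
    [/\ open ON.1, open ON.2, ON.2 x, closure ON.2 `<=` ON.1 &
      ON.1 `<=` V /\ forall y i i', (i < i' < k)%N ->
        ON.1 (iter i T y) -> ~ ON.1 (iter i' T y)].
  have [Ux|] := pselect (boundary U x); last by exists (set0, set0).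
  have [O [Oo Ox OV Or]] := nonreturning_nbhd Taper k Vo (UV _ Ux).
  have [||N [No xN NO]] := closed_open_shrink Xhaus Xcpt (K := [set x]) _ Oo.
  - by apply: compact_closed => //; exact: compact_set1.
  - by move=> _ ->.
  by exists (O, N) => _; split=> //; exact: xN.
have [x Ux|s [sU Us]] := compact_nbhs_subcover (N := fun x => (ON x).2)
    (closed_cpt Xcpt (@closed_boundary U)).
  by have [_ ? ? _ _] := ONP x Ux; exact: open_nbhs_nbhs.
pose L := [seq (closure (ON x).2, (ON x).1) | x <- s].
(* The extra index, padded by empty sets, keeps ['I_r] inhabited, as the default choice [ord0] below
   requires. *)
pose r := (size L).+1.
pose KO j := nth (set0, set0) L j.
have KOP j : KO j = (set0, set0) \/
    exists2 x, boundary U x & KO j = (closure (ON x).2, (ON x).1).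
  rewrite /KO; have [jL|Lj] := ltnP j (size L); last by left; rewrite nth_default.
  have /mapP[x /sU Ux ->] := mem_nth (set0, set0) jL.
  by right; exists x.
have KO1 j : [/\ closed (KO j).1, open (KO j).2 & (KO j).1 `<=` (KO j).2].
  have [->|[x Ux ->]] := KOP j; first by split=> //; [exact: closed0|exact: open0].
  by have [? ? ? ? _] := ONP x Ux; split=> //; exact: closed_closure.
have KO2 j x i i' : (i < i' < k)%N ->
    (KO j).2 (iter i T x) -> ~ (KO j).2 (iter i' T x).
  by have [->//|[y Uy ->]] := KOP j; have [_ _ _ _ [_]] := ONP y Uy; exact.
have KOV j : (KO j).2 `<=` V.
  by have [->//|[y Uy ->]] := KOP j; have [_ _ _ _ []] := ONP y Uy.
have [N [NP Ndim]] := generic_nbhds Tzero dX KO1 KO2 r.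
pose U' := U `|` \bigcup_(j : 'I_r) N j.
have U'o : open U'.
  by apply: openU => //; apply: bigcup_open => j _; have [] := NP j (ltn_ord j).
have bdU' x : boundary U' x -> exists j : 'I_r, boundary (N j) x.
  move=> []; rewrite closureU ((interior_id _).1 U'o) => clU' nU'.
  have nN (j : 'I_r) : ~ N j x by move=> Nj; apply: nU'; right; exists j.
  case: clU' => [Ux|/closure_finite_bigcup[j _ Nj]]; last first.
    exists j; split=> //; rewrite ((interior_id _).1 _)//.
    by have [] := NP j (ltn_ord j).
  have bU : boundary U x.
    by split=> //; rewrite ((interior_id _).1 Uo) => Ux'; apply: nU'; left.
  have [y ys yx] := Us x bU.
  have yL := map_f (fun x => (closure (ON x).2, (ON x).1)) ys.
  have jr : (index (closure (ON y).2, (ON y).1) L < r)%N.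
    by rewrite ltnS ltnW// index_mem.
  case: (nN (Ordinal jr)); have [_ + _] := NP _ jr; apply.
  by rewrite /KO nth_index//; exact: subset_closure.
have bdV (j : 'I_r) : closure (N j) `<=` V.
  by have [_ _ NO] := NP j (ltn_ord j) => x /NO; exact: KOV.
exists U'; split=> //.
- by move=> x; left.
- by move=> x [|[j _ Nj]]; [left|right; apply: bdV; exact: subset_closure Nj].
- by move=> x /bdU'[j [/bdV]].
move=> S.
(* Choosing for each time in [S] one boundary that contains the iterate covers the intersection by
   finitely many closed meets, one for each [f]. *)
pose sq (f : {ffun 'I_k -> 'I_r}) := [seq (val i, val (f i)) | i <- enum S].
have [f _|_ dsum] := @dimlt_closed_bigU _ _ (enum {ffun 'I_k -> 'I_r})
    (fun f => iter_meet N (sq f)) (d - #|S|).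
  split; first exact: closed_iter_meet.
  have -> : #|S| = size (sq f) by rewrite size_map cardE.
  apply: Ndim.
    rewrite /unzip1 -map_comp (eq_map (g := val)) //.
    by rewrite (map_inj_uniq val_inj) enum_uniq.
  by apply/allP => _ /mapP[i _ ->] /=; rewrite !ltn_ord.
apply: dimlt_closed_sub dsum.
  have -> : [set x | forall i, i \in S -> preimg_iter T i (boundary U') x] =
     \bigcap_(i in [set` S]) (iter i T @^-1` boundary U') by [].
  apply: closed_bigI => i _; apply: preimage_closed; last exact: closed_boundary.
  by move=> x _; exact: iter_continuous.
move=> x xS.
have /choice[f fP] (i : 'I_k) : exists j : 'I_r, i \in S -> boundary (N j) (iter i T x).
  have [/xS/bdU'[j]|] := boolP (i \in S); last by exists ord0.
  by exists j.
exists (finfun f); first by rewrite mem_enum.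
by move=> _ /mapP[i iS ->] /=; rewrite ffunE; apply: fP; rewrite mem_enum in iS.
Qed.

End GeneralPosition.

Theorem theorem4p3 (R : realType) (X : pseudoMetricType R)
  (Xhaus : hausdorff_space X) (Xcpt : compact [set: X])
  (d : int) (dimX : covdim_eq [set: X] d)
  (T : X -> X) (Taper : aperiodic T) (Tloc : local_homeomorphism T)
  (Tzero : forall A : set X, covdim_eq A 0 -> covdim_eq (T @` A) 0)
  (U : set X) (Uopen : open U) :
  forall (k : nat) (V : set X), open V -> boundary U `<=` V ->
  exists U' : set X,
    [/\ open U', U `<=` U', U' `<=` U `|` V, boundary U' `<=` V &
        general_position d (fun i : 'I_k => preimg_iter T i (boundary U'))].
Proof.
move=> k V Vo UV.
(* [n] is the dimension plus one; [n = 0] is the case of the empty space. *)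
have [n dn dX] : exists2 n : nat, d = n%:Z - 1 & dimlt [set: X] n.
  case: d dimX => [n|[|n]] [] // dX _; last by exists 0%N => //; exact/dimlt0.
  by exists n.+1; [rewrite -addn1 PoszD addrK|exact/covdim_le_natP].
have [U' [U'o UU' U'V bU' Udim]] :=
  generic_enlargement Xhaus Xcpt Tloc.1 Taper Tzero k dX Uopen Vo UV.
exists U'; split=> // S; rewrite dn; apply: covdim_le_dimlt; exact: Udim.
Qed.
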